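(* Let $(X,X_+,\mathcal{K},f)$ be an ordered Banach space with a base and let $\{T^{k,n}\}$ be a nonhomogeneous discrete Markov chain on $X$. Then the following conditions are equivalent: (i) the chain $\{T^{k,n}\}$ satisfies condition $\mathfrak{D}$: for each integer $k\ge0$ there exist an element $z_k\in\mathcal{K}$, a constant $\lambda_k\in(0,2]$ and an integer $n_k\ge k$, and for every $x\in\mathcal{K}$ one can find $\varphi_{k,x}\in X_+$ with $\sup_{x\in\mathcal{K}}\|\varphi_{k,x}\|\le\frac{\lambda_k}{4}$, such that $$T^{k,n_k}x+\varphi_{k,x}\ge\lambda_k z_k\quad\text{for every }x\in\mathcal{K},$$ and $\liminf_{k\to\infty}\lambda_k>0$; (ii) the chain $\{T^{k,n}\}$ is weakly ergodic, i.e. for each integer $k\ge0$, $\displaystyle\lim_{n\to\infty}\sup_{x,y\in\mathcal{K}}\|T^{k,n}x-T^{k,n}y\|=0$.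
   Context: Ordered Banach space with a base (OBSB) $(X,X_+,\mathcal{K},f)$: $X\neq\{0\}$ is a real ordered vector space with cone $X_+=\{x\in X: x\ge 0\}$ which is generating ($X=X_+-X_+$); $f$ is a linear functional on $X$ that is strictly positive ($f(x)>0$ whenever $x\in X_+$, $x\ne0$); $\mathcal{K}=\{x\in X_+: f(x)=1\}$ is the base. Let $U$ be the convex hull of $\mathcal{K}\cup(-\mathcal{K})$ and $\|x\|=\inf\{\lambda\ge 0: x\in\lambda U\}$. It is assumed that $U$ is linearly bounded (its intersection with every line is bounded), so that $\|\cdot\|$ is a norm, that $X$ is complete for this norm, and that $X_+$ is closed. All norms on $X$ are this norm. A linear operator $T:X\to X$ is positive if $Tx\ge0$ whenever $x\ge 0$; a positive linear operator $T$ is Markov if $T(\mathcal{K})\subset\mathcal{K}$. A nonhomogeneous discrete Markov chain (NDMC) on $X$ is a family of Markov operators $\{T^{m,n}:X\to X\}$ ($0\le m\le n$ integers) with $T^{m,n}=T^{k,n}T^{m,k}$ for all $m\le k\le n$. *)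

(* Defs.v *)
From HB Require Import structures.
From mathcomp Require Import all_boot all_order all_algebra.
From mathcomp Require Import all_classical all_reals all_analysis.
Import Order.TTheory GRing.Theory Num.Theory.
Import numFieldNormedType.Exports.

Set Implicit Arguments.
Unset Strict Implicit.
Unset Printing Implicit Defensive.

Local Open Scope classical_set_scope.
Local Open Scope ring_scope.

Section ordered_space.
Context {R : realType} {V : lmodType R}.
Implicit Types (le : V -> V -> Prop) (f : {scalar V}).

Record ordered_vector_space le : Prop := OrderedVectorSpace {
  ovs_refl : forall x, le x x ;
  ovs_anti : forall x y, le x y -> le y x -> x = y ;
  ovs_trans : forall x y z, le x y -> le y z -> le x z ;
  ovs_add : forall x y z, le x y -> le (x + z) (y + z) ;
  ovs_scale : forall (a : R) x y, 0 <= a -> le x y -> le (a *: x) (a *: y) }.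

Definition cone le : set V := [set x | le 0 x].

Definition generating (C : set V) : Prop :=
  forall x, exists y z, [/\ C y, C z & x = y - z].

Definition strictly_positive le f : Prop :=
  forall x, cone le x -> x <> 0 -> 0 < f x.

Definition base le f : set V := [set x | cone le x /\ f x = 1].

Definition convex_hull (A : set V) : set V :=
  smallest [set B : set V | convex_set B] A.

Definition base_hull le f : set V :=
  convex_hull (base le f `|` [set - x | x in base le f]).

Definition linearly_bounded (A : set V) : Prop :=
  forall a v : V, v <> 0 ->
    exists M : R, forall t : R, A (a + t *: v) -> `|t| <= M.

Definition base_norm le f (x : V) : R :=
  inf [set l : R | 0 <= l /\ [set l *: u | u in base_hull le f] x].

End ordered_space.

(* Completeness is carried by the type: X is a complete normed module whose
   norm is required to be the norm induced by the base. *)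
Record OBSB (R : realType) (X : completeNormedModType R)
    (le : X -> X -> Prop) (f : {scalar X}) : Prop := MkOBSB {
  obsb_nontrivial : exists x : X, x <> 0 ;
  obsb_order : ordered_vector_space le ;
  obsb_generating : generating (cone le) ;
  obsb_strictly_positive : strictly_positive le f ;
  obsb_linearly_bounded : linearly_bounded (base_hull le f) ;
  obsb_norm : forall x : X, `|x| = base_norm le f x ;
  obsb_closed : closed (cone le) }.

Section markov_chains.
Context {R : realType} {X : completeNormedModType R}.
Variables (le : X -> X -> Prop) (f : {scalar X}).

Definition positive_operator (S : {linear X -> X}) : Prop :=
  forall x, le 0 x -> le 0 (S x).

Definition markov_operator (S : {linear X -> X}) : Prop :=
  positive_operator S /\ [set S x | x in base le f] `<=` base le f.

(* Only the values T m n with m <= n belong to the chain; T m m need not be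
   the identity. *)
Definition NDMC (T : nat -> nat -> {linear X -> X}) : Prop :=
  (forall m n, (m <= n)%N -> markov_operator (T m n)) /\
  (forall m k n, (m <= k)%N -> (k <= n)%N ->
     forall x, T m n x = T k n (T m k x)).

(* The suprema are taken in \bar R, where the supremum of an unbounded set is
   +oo; the real-valued sup would return 0. *)
Definition condition_D (T : nat -> nat -> {linear X -> X}) : Prop :=
  exists (z : nat -> X) (lambda : nat -> R) (N : nat -> nat)
         (phi : nat -> X -> X),
    (forall k : nat,
      [/\ base le f (z k),
          0 < lambda k <= 2,
          (k <= N k)%N,
          (forall x, base le f x -> cone le (phi k x)) /\
          (ereal_sup [set `|phi k x|%:E | x in base le f]
             <= (lambda k / 4)%:E)%E &
          forall x, base le f x ->
            le (lambda k *: z k) (T k (N k) x + phi k x)]) /\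
    (0 < limn_einf (fun k => (lambda k)%:E))%E.

Definition weakly_ergodic (T : nat -> nat -> {linear X -> X}) : Prop :=
  forall k : nat,
    (fun n : nat => ereal_sup [set `|T k n x - T k n y|%:E |
                       x in base le f & y in base le f]) @ \oo --> 0%E.

End markov_chains.

(* Main.v *)
Require Import Defs.
From HB Require Import structures.
From mathcomp Require Import all_boot all_order all_algebra.
From mathcomp Require Import all_classical all_reals all_analysis.
From mathcomp Require Import lra.
Import Order.TTheory GRing.Theory Num.Theory.
Import numFieldNormedType.Exports.

(** The unit ball [U] is, up to boundary, the set of differences [p - q] of
    positive elements with [f p + f q = 1].  So the norm is computed by such
    decompositions: [`|p - q| <= f p + f q] ([norm_pos_diff_le]), and every [w]
    is a difference with [f p + f q] as close to [`|w|] as desired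
    ([norm_pos_diff]).

    Markov operators preserve [f], so differences [S x - S y] of images of base
    elements lie in the kernel of [f].  There the two parts of a decomposition
    have the same mass, and [w] is a small multiple of a difference of two base
    elements.  Hence a linear map whose image of the base has diameter at most
    [2 * d] contracts the kernel of [f] by the factor [d]
    ([ker_contraction]): diameters of bases are submultiplicative along
    compositions (Dobrushin's ergodicity coefficient).

    The inequality [S x + phi x >= lambda *: z] gives a common part of mass
    [lambda] to all the [S x], and removing it from both [S x] and [S y] bounds
    the diameter of [S K] by [2 - lambda] ([minorization_diameter]).  As the
    [lambda k] are eventually at least some [c > 0], the chain is composed of
    arbitrarily many blocks which contract by [1 - c / 2], which is weak
    ergodicity.

    Conversely, if all the [T k n x] are at distance less than [1/2] from one of
    them, [z], then [T k n x - z] lies in the kernel and equals [p - q] with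
    both masses less than [1/4].  So [q] serves as [phi k x], with [lambda k = 1]:
    [T k n x + q = z + p >= z]. *)

Set Implicit Arguments.
Unset Strict Implicit.
Unset Printing Implicit Defensive.

Local Open Scope classical_set_scope.
Local Open Scope ring_scope.

(** * The base norm through decompositions into positive elements *)

Section base_norm_decomposition.
Context {R : realType} {X : completeNormedModType R}.
Variables (le : X -> X -> Prop) (f : {scalar X}).
Hypothesis hX : OBSB le f.

Let ord := obsb_order hX.

Lemma cone0 : cone le 0.
Proof. exact: ovs_refl ord 0. Qed.

Lemma coneD (x y : X) : cone le x -> cone le y -> cone le (x + y).
Proof.
move=> x0 y0; apply: (ovs_trans ord y0).
by have := ovs_add ord y x0; rewrite add0r.
Qed.

Lemma coneZ (a : R) (x : X) : 0 <= a -> cone le x -> cone le (a *: x).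
Proof. by move=> a0 /(ovs_scale ord a0); rewrite scaler0. Qed.

Lemma le_cone (x y : X) : le x y <-> cone le (y - x).
Proof.
split=> [xy|xy]; first by have := ovs_add ord (- x) xy; rewrite subrr.
by have := ovs_add ord x xy; rewrite add0r subrK.
Qed.

Lemma functional_ge0 (x : X) : cone le x -> 0 <= f x.
Proof.
move=> x0; have [->|/eqP nx] := eqVneq x 0; first by rewrite linear0.
exact/ltW/(obsb_strictly_positive hX).
Qed.

Lemma base_normalize (p : X) : cone le p -> p <> 0 ->
  base le f ((f p)^-1 *: p).
Proof.
move=> p0 np; have fp := obsb_strictly_positive hX p0 np.
split; first by apply: coneZ; rewrite // invr_ge0 ltW.
by rewrite linearZ /= mulVf// gt_eqF.
Qed.

Lemma base_nonempty : base le f !=set0.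
Proof.
have [x nx] := obsb_nontrivial hX.
have [p [q [p0 q0 xpq]]] := obsb_generating hX x.
have [p00|/eqP np] := eqVneq p 0; last first.
  by eexists; apply: (base_normalize p0 np).
have nq : q <> 0 by move=> q00; apply: nx; rewrite xpq p00 q00 subrr.
by eexists; apply: (base_normalize q0 nq).
Qed.

Lemma cone_scaled_base (p : X) : cone le p ->
  exists2 u, base le f u & p = f p *: u.
Proof.
move=> p0; have [->|/eqP np] := eqVneq p 0.
  by have [u Ku] := base_nonempty; exists u; rewrite // linear0 scale0r.
exists ((f p)^-1 *: p); first exact: base_normalize.
have fp := obsb_strictly_positive hX p0 np.
by rewrite scalerA mulfV ?scale1r// gt_eqF.
Qed.

Lemma base_hull_conv (t : R) (u v : X) : 0 <= t <= 1 ->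
  base le f u -> base le f v -> base_hull le f (t *: u - (1 - t) *: v).
Proof.
move=> /andP[t0 t1] Ku Kv B [cB KB].
have Bu : B u by apply: KB; left.
have Bv : B (- v) by apply: KB; right; exists v.
have := cB u (- v) (Itv01 t0 t1) (mem_set Bu) (mem_set Bv).
by move/set_mem; rewrite /conv /= scalerN.
Qed.

Lemma pos_diff_in_scaled_hull (p q : X) : cone le p -> cone le q ->
  [set l : R | 0 <= l /\ [set l *: u | u in base_hull le f] (p - q)]
    (f p + f q).
Proof.
move=> p0 q0; have fp := functional_ge0 p0; have fq := functional_ge0 q0.
split; first exact: addr_ge0.
have [u Ku pu] := cone_scaled_base p0; have [v Kv qv] := cone_scaled_base q0.
have [s0|s_neq0] := eqVneq (f p + f q) 0.
  (* Both masses vanish; any point of the hull is a witness. *)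
  exists (1 *: u - (1 - 1) *: v).
    by apply: base_hull_conv; rewrite // ler01 lexx.
  have [fp0 fq0] : f p = 0 /\ f q = 0 by split; lra.
  by rewrite s0 scale0r pu qv fp0 fq0 !scale0r subrr.
have s_gt0 : 0 < f p + f q by rewrite lt_neqAle eq_sym s_neq0 addr_ge0.
exists (f p / (f p + f q) *: u - (1 - f p / (f p + f q)) *: v).
  apply: base_hull_conv => //.
  by rewrite divr_ge0 ?addr_ge0//= ler_pdivrMr// mul1r lerDl.
rewrite scalerBr !scalerA mulrBr mulr1 mulrCA mulfV// mulr1.
by rewrite addrAC subrr add0r -pu -qv.
Qed.

Lemma norm_pos_diff_le (p q : X) : cone le p -> cone le q ->
  `|p - q| <= f p + f q.
Proof.
move=> p0 q0; rewrite (obsb_norm hX); apply: ge_inf; last first.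
  exact: pos_diff_in_scaled_hull.
by exists 0 => l [].
Qed.

(** The differences [p - q] of positive elements of total mass [1] form a
    convex set which contains the base and its opposite, hence the hull. *)
Lemma base_hull_pos_diff (w : X) : base_hull le f w ->
  exists p q, [/\ cone le p, cone le q, w = p - q & f p + f q = 1].
Proof.
pose D : set X :=
  [set w | exists p q, [/\ cone le p, cone le q, w = p - q & f p + f q = 1]].
move: w; apply: (@smallest_sub _ _ _ D).
  move=> x y t /set_mem[p [q [p0 q0 -> pq]]] /set_mem[p' [q' [p'0 q'0 -> pq']]].
  have t0 : 0 <= t%:num by [].
  have t1 : 0 <= 1 - t%:num by rewrite subr_ge0; exact: le1.
  apply/mem_set; exists (t%:num *: p + (1 - t%:num) *: p').
  exists (t%:num *: q + (1 - t%:num) *: q'); split.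
  - by apply: coneD; exact: coneZ.
  - by apply: coneD; exact: coneZ.
  - by rewrite /conv /= !scalerBr opprD addrACA.
  rewrite !linearD !linearZ /=.
  have -> : f p = 1 - f q by lra.
  have -> : f p' = 1 - f q' by lra.
  lra.
move=> x [[x0 fx]|[y [y0 fy] <-]].
  by exists x, 0; rewrite subr0 linear0 addr0; split=> //; exact: cone0.
by exists 0, y; rewrite sub0r linear0 add0r; split=> //; exact: cone0.
Qed.

Lemma norm_pos_diff (w : X) (l : R) : `|w| < l ->
  exists p q, [/\ cone le p, cone le q, w = p - q & f p + f q < l].
Proof.
rewrite (obsb_norm hX) => /inf_lt[].
  have [p [q [p0 q0 ->]]] := obsb_generating hX w.
  by eexists; exact: pos_diff_in_scaled_hull.
move=> a [a0 [u /base_hull_pos_diff[p [q [p0 q0 -> pq]]] <-]] al.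
exists (a *: p), (a *: q); split; rewrite ?scalerBr//; try exact: coneZ.
by rewrite !linearZ /= -mulrDr pq mulr1.
Qed.

Lemma ker_norm_pos_diff (w : X) (l : R) : f w = 0 -> `|w| < l ->
  exists p q, [/\ cone le p, cone le q, w = p - q, f p = f q & f q < l / 2].
Proof.
move=> fw /norm_pos_diff[p [q [p0 q0 wpq pql]]]; exists p, q.
have fpq : f p = f q by apply/eqP; rewrite -subr_eq0 -linearB -wpq fw.
by split=> //; lra.
Qed.

Lemma functional_le_norm (x : X) : f x <= `|x|.
Proof.
apply/ler_addgt0Pr => e e0.
have /norm_pos_diff[p [q [p0 q0 xpq pql]]] : `|x| < `|x| + e by rewrite ltrDl.
by rewrite [in f x]xpq linearB; have := functional_ge0 q0; lra.
Qed.

(** * Contraction on the kernel of the functional *)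

(** For [w] in the kernel, [w = r *: (u - v)] with [u], [v] in the base and
    [r] barely above [`|w| / 2]; so [S w] has norm at most [r * (2 * d)]. *)
Lemma ker_contraction (S : {linear X -> X}) (d : R) :
  0 <= d ->
  (forall x y, base le f x -> base le f y -> `|S x - S y| <= 2 * d) ->
  forall w, f w = 0 -> `|S w| <= d * `|w|.
Proof.
move=> d0 dS w fw.
(* The infimum defining the norm need not be attained. *)
have bound l : `|w| < l -> `|S w| <= d * l.
  move=> /(ker_norm_pos_diff fw)[p [q [p0 q0 -> fpq ql]]].
  have [u Ku ->] := cone_scaled_base p0; have [v Kv ->] := cone_scaled_base q0.
  have fq := functional_ge0 q0; rewrite fpq -scalerBr linearZ linearB normrZ.
  rewrite ger0_norm//; apply: (le_trans (ler_wpM2l fq (dS _ _ Ku Kv))).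
  by nra.
apply/ler_addgt0Pr => e e0.
have d1 : 0 < d + 1 by lra.
have := bound (`|w| + e / (d + 1)); rewrite ltrDl divr_gt0// => /(_ isT).
move=> /le_trans; apply; rewrite mulrDr lerD2l mulrA ler_pdivrMr//; nra.
Qed.

Lemma markov_base (S : {linear X -> X}) (x : X) :
  markov_operator le f S -> base le f x -> base le f (S x).
Proof. by move=> [_ KS] Kx; apply: KS; exists x. Qed.

Lemma base_sub_ker (x y : X) : base le f x -> base le f y -> f (x - y) = 0.
Proof. by move=> [_ fx] [_ fy]; rewrite linearB fx fy subrr. Qed.

Lemma base_sub_norm (x y : X) : base le f x -> base le f y -> `|x - y| <= 2.
Proof.
by move=> [x0 fx] [y0 fy]; have := norm_pos_diff_le x0 y0; rewrite fx fy; lra.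
Qed.

Lemma markov_ker_nonexpansive (S : {linear X -> X}) : markov_operator le f S ->
  forall w, f w = 0 -> `|S w| <= `|w|.
Proof.
move=> mS w fw; rewrite -[leRHS]mul1r; apply: ker_contraction => // x y Kx Ky.
by rewrite mulr1; apply: base_sub_norm; exact: markov_base.
Qed.

(** With [a x := S x + phi x - l *: z >= 0], the common part [l *: z] cancels in
    [S x - S y = (a x + phi y) - (a y + phi x)], a difference of positive
    elements of total mass [2 * (1 - l + f (phi x) + f (phi y))]; the bound
    [l / 4] on the corrections [phi] leaves [2 - l]. *)
Lemma minorization_diameter (S : {linear X -> X}) (z : X) (l : R)
    (phi : X -> X) :
  markov_operator le f S -> base le f z ->
  (forall x, base le f x -> cone le (phi x) /\ `|phi x| <= l / 4) ->
  (forall x, base le f x -> le (l *: z) (S x + phi x)) ->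
  forall x y, base le f x -> base le f y -> `|S x - S y| <= 2 * (1 - l / 2).
Proof.
move=> mS [_ fz] hphi hle x y Kx Ky.
have [px nx] := hphi _ Kx; have [py ny] := hphi _ Ky.
have /le_cone ax := hle _ Kx; have /le_cone ay := hle _ Ky.
have [_ fSx] := markov_base mS Kx; have [_ fSy] := markov_base mS Ky.
have fx := le_trans (functional_le_norm (phi x)) nx.
have fy := le_trans (functional_le_norm (phi y)) ny.
have -> : S x - S y =
    (S x + phi x - l *: z + phi y) - (S y + phi y - l *: z + phi x).
  pose r := phi x - l *: z + phi y.
  have -> : S x + phi x - l *: z + phi y = S x + r by rewrite /r !addrA.
  have -> : S y + phi y - l *: z + phi x = r + S y.
    by rewrite /r [LHS]addrC -2![RHS]addrA [phi y + _]addrC [- _ + _]addrC.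
  by rewrite addrKA.
apply: (le_trans (norm_pos_diff_le (coneD ax py) (coneD ay px))).
rewrite !(linearD f) !(linearN f) linearZ /= fSx fSy fz; lra.
Qed.

End base_norm_decomposition.

(** * Iterated contractions along the chain *)

Lemma limn_einf_gt0 (R : realType) (u : nat -> R) :
  (0 < limn_einf (fun k => (u k)%:E))%E ->
  exists (c : R) (k0 : nat), 0 < c /\ forall k, (k0 <= k)%N -> c <= u k.
Proof.
rewrite limn_einf_lim (cvg_lim _ (@cvg_einfs_sup _ _))//.
move=> /ereal_sup_gt[_ [k0 _ <-]]; rewrite /einfs /=.
have eu k : (k0 <= k)%N ->
    (ereal_inf (sdrop (fun k => (u k)%:E) k0) <= (u k)%:E)%E.
  by move=> kk; apply: ereal_inf_lbound; exists k.
move: eu; case: (ereal_inf _) => [c eu c0|/(_ _ (leqnn _))|] //.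
exists c, k0; split; first by move: c0; rewrite lte_fin.
by move=> k /eu; rewrite lee_fin.
Qed.

Section chain.
Context {R : realType} {X : completeNormedModType R}.
Variables (le : X -> X -> Prop) (f : {scalar X}).
Variable T : nat -> nat -> {linear X -> X}.
Hypotheses (hX : OBSB le f) (hT : NDMC le f T).

(** The [j] blocks are [T k' (N k')] with [k'] running through the iterates of
    [N] from [maxn k k0]; the operators before the first block and after the
    last one do not increase norms on the kernel.  The iterates need not grow:
    a block [T k' k'] may be composed with itself. *)
Lemma iterated_contraction (q : R) (k0 : nat) (N : nat -> nat) :
  0 <= q ->
  (forall k, (k0 <= k)%N -> (k <= N k)%N /\
     forall x y, base le f x -> base le f y ->
       `|T k (N k) x - T k (N k) y| <= 2 * q) ->
  forall k j : nat, exists2 m, (k <= m)%N & forall n, (m <= n)%N ->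
    forall x y, base le f x -> base le f y ->
      `|T k n x - T k n y| <= 2 * q ^+ j.
Proof.
move=> q0 contr k j; have [mT compT] := hT.
have kerT m x y : (k <= m)%N -> base le f x -> base le f y ->
    f (T k m x - T k m y) = 0.
  by move=> km Kx Ky; apply: (@base_sub_ker _ _ le); apply: markov_base => //;
    exact: mT.
have [m [km k0m bm]] : exists m, [/\ (k <= m)%N, (k0 <= m)%N &
    forall x y, base le f x -> base le f y ->
      `|T k m x - T k m y| <= 2 * q ^+ j].
  elim: j => [|j [m [km k0m bm]]].
    exists (maxn k k0); split; rewrite ?leq_maxl ?leq_maxr// => x y Kx Ky.
    rewrite expr0 mulr1; apply: (base_sub_norm hX);
      by apply: markov_base => //; exact/mT/leq_maxl.
  have [mN cN] := contr m k0m.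
  exists (N m); split; [exact: leq_trans mN|exact: leq_trans mN|].
  move=> x y Kx Ky; rewrite !(compT k m (N m))// -linearB.
  apply: (le_trans (ker_contraction hX q0 cN (kerT _ _ _ km Kx Ky))).
  by rewrite exprS mulrCA ler_wpM2l// bm.
exists m => // n mn x y Kx Ky; rewrite !(compT k m n)// -linearB.
apply: le_trans (bm _ _ Kx Ky); apply: (markov_ker_nonexpansive hX).
  exact: mT.
exact: kerT.
Qed.

(** The suprema are nonnegative because the base is nonempty, and finite
    whenever they have a real bound. *)
Lemma weakly_ergodicP : weakly_ergodic le f T <->
  forall (k : nat) (e : R), 0 < e ->
    exists2 m : nat, (k <= m)%N & forall n, (m <= n)%N ->
      forall x y, base le f x -> base le f y -> `|T k n x - T k n y| <= e.
Proof.
have [u Ku] := base_nonempty hX.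
split=> [we k e e0|we k].
  have /fine_cvgP[fin /cvgrPdist_le/(_ _ e0) cvg] := we k.
  have [m _ hm] := filterI fin cvg.
  exists (maxn k m); first exact: leq_maxl.
  move=> n; rewrite geq_max => /andP[_ /hm[/= nfin]].
  rewrite sub0r normrN => /(le_trans (ler_norm _)) ne x y Kx Ky.
  rewrite -lee_fin; apply: (@le_trans _ _ (ereal_sup
      [set `|T k n x - T k n y|%:E | x in base le f & y in base le f])).
    by apply: ereal_sup_ubound; exists x => //; exists y.
  by rewrite -(fineK nfin) lee_fin.
have sup_ge0 n : (0 <= ereal_sup
    [set `|T k n x - T k n y|%:E | x in base le f & y in base le f])%E.
  apply: ereal_sup_ubound; exists u => //; exists u => //.
  by rewrite subrr normr0.
have sup_le e : 0 < e -> \forall n \near \oo, (ereal_sup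
    [set `|T k n x - T k n y|%:E | x in base le f & y in base le f] <= e%:E)%E.
  move=> /(we k)[m _ hm]; exists m => // n /= mn; apply: ge_ereal_sup.
  by move=> _ [x Kx [y Ky <-]]; rewrite lee_fin; exact: hm.
apply/fine_cvgP; split.
  apply: filterS (sup_le 1 ltr01) => n n1; rewrite fin_numElt.
  by rewrite (lt_le_trans _ (sup_ge0 n)) ?ltNyr//= (le_lt_trans n1) ?ltry.
apply/cvgrPdist_le => e e0; apply: filterS (sup_le e e0) => n ne /=.
have nfin : ereal_sup [set `|T k n x - T k n y|%:E |
    x in base le f & y in base le f] \is a fin_num.
  by rewrite fin_numElt (lt_le_trans _ (sup_ge0 n)) ?ltNyr//=
    (le_lt_trans ne) ?ltry.
by rewrite sub0r normrN ger0_norm ?fine_ge0// -lee_fin fineK.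
Qed.

Lemma condition_D_weakly_ergodic :
  condition_D le f T -> weakly_ergodic le f T.
Proof.
move=> [z [lambda [N [phi [hD /limn_einf_gt0[c [k0 [c0 hc]]]]]]]].
have c2 : c <= 2.
  have [_ /andP[_ l2] _ _ _] := hD k0.
  exact: le_trans (hc _ (leqnn _)) l2.
pose q := 1 - c / 2.
have [q0 q1] : 0 <= q /\ q < 1 by rewrite /q; split; lra.
have contr k : (k0 <= k)%N -> (k <= N k)%N /\
    forall x y, base le f x -> base le f y ->
      `|T k (N k) x - T k (N k) y| <= 2 * q.
  move=> /hc cl; have [Kz _ kN [phi0 phi_sup] hle] := hD k.
  split=> // x y Kx Ky.
  apply: (@le_trans _ _ (2 * (1 - lambda k / 2))); last by rewrite /q; lra.
  apply: (minorization_diameter hX _ Kz _ hle) => //.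
    by have [mT _] := hT; exact: mT.
  move=> w Kw; split; first exact: phi0.
  rewrite -lee_fin; apply: le_trans phi_sup.
  by apply: ereal_sup_ubound; exists w.
apply/weakly_ergodicP => k e e0.
have /cvgrPdist_le/(_ _ e0)[j _ /(_ j (leqnn j)) /= hj] :
    geometric 2 q @ \oo --> (0 : R).
  by apply: cvg_geometric; rewrite ger0_norm.
have [m km hm] := iterated_contraction q0 contr k j.
exists m => // n mn x y Kx Ky; apply: le_trans (hm n mn x y Kx Ky) _.
by apply: le_trans hj; rewrite sub0r normrN ler_norm.
Qed.

Lemma weakly_ergodic_condition_D :
  weakly_ergodic le f T -> condition_D le f T.
Proof.
move=> /weakly_ergodicP we; have [mT _] := hT.
have [u Ku] := base_nonempty hX.
have e0 : 0 < 4^-1 :> R by lra.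
have /choice[N hN] : forall k, exists m, (k <= m)%N /\
    forall x y, base le f x -> base le f y -> `|T k m x - T k m y| <= 4^-1.
  by move=> k; have [m km hm] := we k _ e0; exists m; split=> //; exact: hm.
pose z k := T k (N k) u.
have KT k x : base le f x -> base le f (T k (N k) x).
  by apply: markov_base; apply: mT; have [] := hN k.
have phi_ex (kx : nat * X) : exists p, base le f kx.2 ->
    [/\ cone le p, `|p| <= 4^-1 & le (z kx.1) (T kx.1 (N kx.1) kx.2 + p)].
  case: kx => k x /=; have [Kx|nKx] := pselect (base le f x); last by exists 0.
  (* The strict bound [1/2] makes both masses of a decomposition below [1/4]. *)
  have zx : `|T k (N k) x - z k| < 2^-1.
    by have [_ /(_ _ _ Kx Ku)] := hN k; rewrite /z; lra.
  have [p [q [p0 q0 wpq _ ql]]] := ker_norm_pos_diff hX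
    (base_sub_ker (KT k _ Kx) (KT k _ Ku)) zx.
  exists q => _; split=> //.
    have := norm_pos_diff_le hX q0 (cone0 hX).
    by rewrite subr0 linear0 addr0; lra.
  by apply/(le_cone hX); rewrite addrAC wpq subrK.
have /choice[phi hphi] := phi_ex.
exists z, (fun=> 1), N, (fun k x => phi (k, x)); split=> [k|].
  split.
  - exact: KT.
  - by apply/andP; split; lra.
  - by have [] := hN k.
  - split=> [x Kx|]; first by have [] := hphi (k, x) Kx.
    apply: ge_ereal_sup => _ [x Kx <-]; rewrite lee_fin mul1r.
    by have [] := hphi (k, x) Kx.
  - by move=> x Kx; rewrite scale1r; have [] := hphi (k, x) Kx.
by rewrite (cvg_limn_einf_sup (@cvg_cst _ (1%:E : \bar R) _ _ _)).1 lte_fin.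
Qed.

End chain.

Theorem theorem4p1 (R : realType) (X : completeNormedModType R)
  (le : X -> X -> Prop) (f : {scalar X}) (T : nat -> nat -> {linear X -> X})
  (hX : OBSB le f) (hT : NDMC le f T) :
  condition_D le f T <-> weakly_ergodic le f T.
Proof.
split; first exact: condition_D_weakly_ergodic.
exact: weakly_ergodic_condition_D.
Qed.
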